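(* There are absolute constants $N, C$ with the following property. Let $n,m \in \mathbb{N}$ with $n \geq N$ and $m \leq n$. Let $p \in (0,1)$ satisfy $p \geq C (\log^2 n)/m$, and let $d := pm$. Let $M$ be the $m \times n$ random matrix with independent entries $M_{ij} \sim \mathrm{Ber}(p)$. Then with probability $1 - O(1/m^2)$, it holds that for all $b \leq m/d^4$, the matrix $M$ is $(b, 2b, d^4 n^6, m/d^3)$-erasure-robust.
   Context: For $x\in\mathbb{R}^n$, $\|x\|_0$ is the number of nonzero entries. For a matrix $M$ and a set of row indices $B$, $M_{B^c}$ is the submatrix of rows not in $B$; for $C\subseteq[n]$, $x_{C^c}$ is the restriction of $x$ to coordinates outside $C$. A matrix $M \in \mathbb{R}^{m\times n}$ is $(b,b',\eta,\tau)$-erasure-robust if for every $B \subseteq [m]$ with $|B| \leq b$ there is a set $C \subseteq [n]$ with $|C| \leq b'$ such that every $x \in \mathbb{R}^n$ satisfies either $\|x\|_0 \geq \tau$ or $\|x_{C^c}\|_2 \leq \eta\|M_{B^c}x\|_\infty$. *)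

(* Defs.v *)
From HB Require Import structures.
From mathcomp Require Import all_boot all_order all_algebra.
From mathcomp Require Import all_classical all_reals all_analysis.

Set Implicit Arguments.
Unset Strict Implicit.
Unset Printing Implicit Defensive.

Import Order.TTheory GRing.Theory Num.Theory.

Local Open Scope classical_set_scope.
Local Open Scope ring_scope.

Definition l0norm (R : realType) (n : nat) (x : 'cV[R]_n) : nat :=
  #|[set i : 'I_n | x i 0 != 0]%SET|.

Definition l2norm (R : realType) (n : nat) (x : 'cV[R]_n) : R :=
  Num.sqrt (\sum_(i < n) x i 0 ^+ 2).

(* The rows of A with index outside B, in increasing order. For a column vector
   x, [remove_rows C x] is the restriction of x to the coordinates outside C. *)
Definition remove_rows (R : realType) (m n : nat) (B : {set 'I_m})
    (A : 'M[R]_(m, n)) : 'M[R]_(#|~: B|, n) :=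
  rowsub (@enum_val _ (mem (~: B))) A.

(* On column vectors, the library's entrywise maximum norm [mx_norm] is the
   sup norm. *)
Definition erasure_robust (R : realType) (m n : nat) (M : 'M[R]_(m, n))
    (b b' : nat) (eta tau : R) : Prop :=
  forall B : {set 'I_m}, (#|B| <= b)%N ->
  exists C : {set 'I_n}, (#|C| <= b')%N /\
    forall x : 'cV[R]_n,
      tau <= (l0norm x)%:R \/
      l2norm (remove_rows C x) <= eta * mx_norm (remove_rows B M *m x).

Definition mutually_independent (I : finType) (d d' : measure_display)
    (T : measurableType d) (T' : measurableType d') (R : realType)
    (P : probability T R) (X : I -> {RV P >-> T'}) : Prop :=
  forall (J : {set I}) (A : I -> set T'),
    (forall i, i \in J -> measurable (A i)) ->
    P (\bigcap_(i in [set` J]) (X i @^-1` A i)) =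
    (\prod_(i in J) P (X i @^-1` A i))%E.

(* The entries of a random 0/1 matrix are given as Boolean random variables,
   which is where the library's Bernoulli law lives. *)
Definition iid_bernoulli (m n : nat) (d : measure_display)
    (T : measurableType d) (R : realType) (P : probability T R) (p : R)
    (X : 'I_m * 'I_n -> {RV P >-> bool}) : Prop :=
  (forall ij, distribution P (X ij) =1 bernoulli_prob p) /\
  mutually_independent X.

Definition random_mx (m n : nat) (d : measure_display)
    (T : measurableType d) (R : realType) (P : probability T R)
    (X : 'I_m * 'I_n -> {RV P >-> bool}) (w : T) : 'M[R]_(m, n) :=
  \matrix_(i, j) (X (i, j) w)%:R.

(* Main.v *)
Require Import Defs.
From HB Require Import structures.
From mathcomp Require Import all_boot all_order all_algebra.
From mathcomp Require Import all_classical all_reals all_analysis.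
From mathcomp Require Import zify lra ring.

(* View the matrix as a random bipartite graph. With high probability every
   column has degree at least d/4 and every small set S of columns has excess
   (edges minus neighbours) at most d|S|/64; the latter follows from the
   exponential moment E 2^(excess of a row) <= 1 + 2(p|S|)^2 and a union bound.
   On this event, given the erased rows B, let C be the small set of columns
   maximizing half the edges of C minus |N(C) \ B|. The degrees and the excess
   bound force |C| <= |B|, and every small D disjoint from C has many unique
   neighbours outside B and N(C), where the coordinates in C are invisible.
   Order the remaining coordinates of a sparse x by size and pick the j
   maximizing |x_j| rk_j (rk_j + 1). The coordinates at least as large as x_j
   cannot be cancelled at their unique neighbours by the smaller ones, whose
   total contribution is controlled by the excess bound at every rank; so
   |x_j| <= 2 |Mx|_oo outside B, and |x_i| <= n(n + 1) |Mx|_oo for all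
   remaining i. *)

Set Implicit Arguments.
Unset Strict Implicit.
Unset Printing Implicit Defensive.

Import Order.TTheory GRing.Theory Num.Theory.

Local Open Scope ring_scope.

(** * Degrees, neighbourhoods and excess in a bipartite graph *)

Definition row_deg (I J : finType) (A : I -> J -> bool) (S : {set J}) (i : I) :
  nat := #|[set j in S | A i j]|.

Definition col_deg (I J : finType) (A : I -> J -> bool) (j : J) : nat :=
  #|[set i | A i j]|.

Definition nbhd (I J : finType) (A : I -> J -> bool) (S : {set J}) : {set I} :=
  [set i | (0 < row_deg A S i)%N].

(* Rows missing [S] contribute [0.-1 = 0]. *)
Definition excess (I J : finType) (A : I -> J -> bool) (S : {set J}) : nat :=
  (\sum_i (row_deg A S i).-1)%N.

Definition unique_nbhd (I J : finType) (A : I -> J -> bool) (S : {set J}) :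
  {set I} := [set i | row_deg A S i == 1%N].

Lemma sum_row_deg (I J : finType) (A : I -> J -> bool) (S : {set J})
    (U : {set I}) :
  (\sum_(i in U) row_deg A S i = \sum_(j in S) #|[set i in U | A i j]|)%N.
Proof.
under eq_bigr do rewrite /row_deg -sum1_card big_mkcond.
rewrite exchange_big [RHS]big_mkcond/=; apply: eq_bigr => j _.
case: ifPn => [jS|jS]; last by rewrite big1// => i _; rewrite inE (negPf jS).
rewrite -sum1_card [RHS]big_mkcond [LHS]big_mkcond; apply: eq_bigr => i _.
by rewrite !inE jS; case: (i \in U).
Qed.

Lemma card_nbhd_excess (I J : finType) (A : I -> J -> bool) (S : {set J}) :
  (#|nbhd A S| + excess A S = \sum_(j in S) col_deg A j)%N.
Proof.
have -> : (\sum_(j in S) col_deg A j = \sum_(i in [set: I]) row_deg A S i)%N.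
  rewrite sum_row_deg; apply: eq_bigr => j _.
  by apply: eq_card => i; rewrite !inE.
rewrite -sum1_card big_mkcond -big_split [RHS]big_mkcond/=.
by apply: eq_bigr => i _; rewrite !inE; case: (row_deg A S i).
Qed.

Lemma row_degU (I J : finType) (A : I -> J -> bool) (S T : {set J}) (i : I) :
  [disjoint S & T] ->
  row_deg A (S :|: T) i = (row_deg A S i + row_deg A T i)%N.
Proof.
move=> dST; rewrite /row_deg -cardsUI.
have -> : [set j in S | A i j] :&: [set j in T | A i j] = finset.set0.
  apply/setP => j; rewrite !inE; case: (boolP (j \in S)) => //= jS.
  by rewrite (disjointFr dST jS)/= andbF.
rewrite cards0 addn0; congr #|pred_of_set _|; apply/setP => j.
by rewrite !inE andb_orl.
Qed.

Lemma nbhdU (I J : finType) (A : I -> J -> bool) (S T : {set J}) :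
  [disjoint S & T] -> nbhd A (S :|: T) = nbhd A S :|: nbhd A T.
Proof. by move=> dST; apply/setP => i; rewrite !inE row_degU// addn_gt0. Qed.

(** A neighbour that is not unique has at least two edges into [S], so it adds at least 1 to the
    excess. *)
Lemma nbhd_unique_excess (I J : finType) (A : I -> J -> bool) (S : {set J})
    (B : {set I}) :
  (#|nbhd A S :\: B| <= #|unique_nbhd A S :\: B| + excess A S)%N.
Proof.
rewrite -!sum1_card ![(\sum_(_ in _ :\: _) _)%N]big_mkcond -big_split/=.
by apply: leq_sum => i _; rewrite !inE; case: (i \in B) => //=;
  case: (row_deg A S i) => [|[]].
Qed.

(** A row of [U] spends its one non-excess edge on [S], so each of its edges into [T :\: S] counts
    towards the excess of [T]. *)
Lemma excess_subset (I J : finType) (A : I -> J -> bool) (S T : {set J})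
    (U : {set I}) : S \subset T -> U \subset unique_nbhd A S ->
  (\sum_(j in T :\: S) #|[set i in U | A i j]| <= excess A T)%N.
Proof.
move=> sST sU; rewrite -sum_row_deg big_mkcond/=; apply: leq_sum => i _.
case: ifPn => // iU; have := fintype.subsetP sU i iU; rewrite inE => /eqP rS.
have -> : T = S :|: (T :\: S).
  by rewrite -[in LHS](finset.setID T S) (finset.setIidPr sST).
rewrite row_degU ?rS//.
  rewrite (_ : (S :|: _) :\: S = T :\: S)//.
  by apply/setP => j; rewrite !inE; case: (j \in S).
by rewrite -finset.setI_eq0; apply/eqP/setP => j; rewrite !inE; case: (j \in S).
Qed.

(** * Deterministic expansion: the absorbing set and the sup bound *)

(** Let [C] maximize [f S] = e(S)/2 - |N(S) \ B| over small sets, e(S) being the number of edges at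
    S. Comparison with the empty set gives |B| >= e(C)/2 - excess(C) >= (1/2 - 1/16) dlt |C|, which
    is at least |C| because dlt >= 4. Comparison with the union of C and D shows that D has at least
    e(D)/2 >= dlt |D| / 2 neighbours outside B and N(C); all but excess(D) <= dlt |D| / 16 of them
    are unique, whence 7/16. *)
Lemma absorbing_set (R : realFieldType) (I J : finType) (A : I -> J -> bool)
    (small : pred {set J}) (dlt : R) (B : {set I}) :
    4 <= dlt -> (forall j, dlt <= (col_deg A j)%:R) -> small finset.set0 ->
    (forall S, small S -> (excess A S)%:R <= dlt / 16 * #|S|%:R) ->
  exists C : {set J}, [/\ small C, (#|C| <= #|B|)%N &
    forall D : {set J}, [disjoint C & D] -> small D -> small (C :|: D) ->
      7 / 16 * dlt * #|D|%:R
        <= #|unique_nbhd A D :\: (B :|: nbhd A C)|%:R :> R].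
Proof.
move=> dlt4 degA sm0 excA.
pose e (S : {set J}) : R := (\sum_(j in S) col_deg A j)%:R.
pose f (S : {set J}) : R := e S / 2 - #|nbhd A S :\: B|%:R.
have e_ge (S : {set J}) : dlt * #|S|%:R <= e S.
  rewrite /e natr_sum mulr_natr -sumr_const; exact: ler_sum.
case: (@arg_maxP _ _ _ finset.set0 small f sm0) => C smC maxC0.
have maxC S : small S -> f S <= f C by exact: maxC0.
have f0 : f finset.set0 = 0.
  rewrite /f /e big_set0 mul0r sub0r (_ : nbhd A finset.set0 = finset.set0) ?finset.set0D ?cards0 ?oppr0//.
  apply/setP => i; rewrite !inE /row_deg (_ : [set j in finset.set0 | _] = finset.set0) ?cards0//.
  by apply/setP => j; rewrite !inE.
exists C; split=> //.
  have := maxC _ sm0; rewrite f0 /f /e => fC.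
  have := e_ge C; rewrite /e => eC.
  have := excA _ smC => exC.
  have := congr1 (fun k => k%:R : R) (card_nbhd_excess A C); rewrite natrD => nC.
  have nBC : (#|nbhd A C|%:R <= #|B|%:R + #|nbhd A C :\: B|%:R :> R).
    by rewrite -natrD ler_nat -(cardsID B (nbhd A C)) leq_add2r subset_leq_card ?finset.subsetIr.
  rewrite -(ler_nat R).
  have : 4 * #|C|%:R <= dlt * #|C|%:R by rewrite ler_wpM2r.
  have : 0 <= #|C|%:R :> R by [].
  lra.
move=> D dCD smD smCD.
have := maxC _ smCD; rewrite /f /e.
have -> : (\sum_(j in C :|: D) col_deg A j =
    \sum_(j in C) col_deg A j + \sum_(j in D) col_deg A j)%N.
  by rewrite (@big_setID _ _ _ _ _ C)/= finset.setUK finset.setDUl finset.setDv finset.set0U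
    (finset.setDidPl _)// disjoint_sym.
have -> : (#|nbhd A (C :|: D) :\: B| =
    #|nbhd A C :\: B| + #|nbhd A D :\: (B :|: nbhd A C)|)%N.
  rewrite nbhdU// -(cardsID (nbhd A C) ((nbhd A C :|: nbhd A D) :\: B)).
  congr (_ + _)%N; apply: eq_card => i; rewrite !inE;
    by case: (i \in B); case: (0 < row_deg A C i)%N => //=; rewrite ?andbF.
have := e_ge D; rewrite /e => eD.
have := excA _ smD.
have := nbhd_unique_excess A D (B :|: nbhd A C); rewrite -(ler_nat R) !natrD.
lra.
Qed.

(* Summation by parts against the telescoping weight 1/(l(l+1)). *)
Lemma weighted_rank_sum (R : realFieldType) (J : finType) (D : {set J})
    (r : J -> R) (rk : J -> nat) (a : R) (k : nat) : 0 <= a -> (0 < k)%N ->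
    (forall j, j \in D -> (k < rk j)%N) ->
    (forall l, \sum_(j in D | (rk j <= l)%N) r j <= a * l%:R) ->
  \sum_(j in D) r j / ((rk j)%:R * (rk j).+1%:R) <= 2 * a / k.+1%:R.
Proof.
move=> a0 k0 rkD sumr.
pose Q l := \sum_(j in D | (rk j <= l)%N) r j / ((rk j)%:R * (rk j).+1%:R).
pose S l := \sum_(j in D | (rk j <= l)%N) r j.
have split_le F l : \sum_(j in D | (rk j <= l.+1)%N) F j =
    \sum_(j in D | (rk j <= l)%N) F j + \sum_(j in D | rk j == l.+1) F j :> R.
  rewrite (bigID (fun j => (rk j <= l)%N))/=; congr (_ + _); apply: eq_bigl => j;
    by case: (j \in D) => //=; lia.
(* Moving the boundary term to the left makes the increment at l equal to 2 S(l) / (l(l+1)(l+2)) <=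
   2a / ((l+1)(l+2)), which telescopes. At t = 0 both sums are empty, since all ranks exceed k. *)
have step t : Q (k + t)%N - S (k + t)%N / ((k + t)%:R * (k + t).+1%:R)
    <= 2 * a * (k.+1%:R^-1 - (k + t).+1%:R^-1).
  elim: t => [|t IH].
    rewrite addn0 /Q /S !big_pred0 ?mul0r ?subrr ?mulr0//;
      by move=> j; case: (boolP (j \in D)) => //= /rkD; lia.
  rewrite addnS; set l := (k + t)%N in IH *.
  have l0 : 0 < l%:R :> R by rewrite ltr0n /l; lia.
  have -> : Q l.+1 = Q l + (S l.+1 - S l) / (l.+1%:R * l.+2%:R).
    rewrite /Q /S !split_le [X in (X / _)]addrC addKr; congr (_ + _).
    by rewrite mulr_suml; apply: eq_bigr => j /andP[_ /eqP ->].
  have Sl := sumr l; rewrite -/(S l) in Sl.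
  have l1 : l.+1%:R = l%:R + 1 :> R by rewrite -natr1.
  have l2 : l.+2%:R = l%:R + 2 :> R by rewrite -addn2 natrD.
  rewrite l1 in IH *; rewrite l2.
  have : S l * (2 / (l%:R * (l%:R + 1) * (l%:R + 2))) <=
      a * l%:R * (2 / (l%:R * (l%:R + 1) * (l%:R + 2))).
    by apply: ler_wpM2r => //; rewrite divr_ge0// !mulr_ge0//; lra.
  have -> : a * l%:R * (2 / (l%:R * (l%:R + 1) * (l%:R + 2))) =
      2 * a * ((l%:R + 1)^-1 - (l%:R + 2)^-1) by field; apply/and3P; split; lra.
  have -> : S l * (2 / (l%:R * (l%:R + 1) * (l%:R + 2))) =
      S l / (l%:R * (l%:R + 1)) - S l / ((l%:R + 1) * (l%:R + 2)).
    by field; apply/and3P; split; lra.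
  rewrite mulrBl; move: IH; set u := S l / _; set v := S l / _; set w := S l.+1 / _.
  move: (k.+1%:R^-1) ((l%:R + 1)^-1) ((l%:R + 2)^-1) => x y z.
  rewrite !mulrBr; move: (2 * a * x) (2 * a * y) (2 * a * z) => x' y' z'. lra.
(* A crude upper bound for all ranks in [D]: at l = k + t the partial sum is the full sum, and the
   boundary term, at most a/(l+1), is absorbed by -2a/(l+1). *)
pose t := (\sum_(j in D) rk j)%N.
have le_rk j : j \in D -> (rk j <= k + t)%N.
  by move=> jD; rewrite /t (bigD1 j jD)/=; lia.
have := step t; set l := (k + t)%N in le_rk *.
have -> : Q l = \sum_(j in D) r j / ((rk j)%:R * (rk j).+1%:R).
  by apply: eq_bigl => j; case: (boolP (j \in D)) => // /le_rk.
have l0 : 0 < l%:R :> R by rewrite ltr0n /l; lia.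
have : S l / (l%:R * l.+1%:R) <= a / l.+1%:R.
  rewrite ler_pdivrMr ?mulr_gt0//.
  by rewrite (_ : a / _ * _ = a * l%:R) ?sumr//; field; lra.
have : 0 <= a / l.+1%:R by rewrite divr_ge0.
rewrite mulrBr -!mulrA; move: (a / l.+1%:R) (a / k.+1%:R) (S l / _) => x y z.
lra.
Qed.

(** Let [js] maximize |x_j| phi(j), and suppose lam = |x_js| > 2 eps. The k coordinates of size at
    least lam have at least 7/16 dlt k unique neighbours in [G], and at each of them the smaller
    coordinates must add up to at least lam - eps >= lam/2: in total 7/32 dlt k lam. Maximality
    gives |x_j| <= lam phi(js) / phi(j), so by [weighted_rank_sum] that total is at most lam k dlt /
    8, a contradiction. *)
Lemma sup_bound (R : realFieldType) (I J : finType) (A : I -> J -> bool)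
    (G : {set I}) (S : {set J}) (x : J -> R) (dlt eps : R) :
    0 < dlt -> 0 <= eps ->
    (forall D : {set J}, D \subset S ->
      7 / 16 * dlt * #|D|%:R <= #|unique_nbhd A D :&: G|%:R :> R) ->
    (forall D : {set J}, D \subset S ->
      (excess A D)%:R <= dlt / 16 * #|D|%:R) ->
    (forall i, i \in G -> `|\sum_(j in S | A i j) x j| <= eps) ->
  forall j, j \in S -> `|x j| <= eps * #|S|%:R * #|S|.+1%:R.
Proof.
move=> dlt0 eps0 uniqS excS sumx j0 j0S.
(* Ties count in the rank, so level sets are complete: a coordinate outside [lev js] is strictly
   smaller than [x js] and has strictly larger rank. *)
pose lev j := [set l in S | `|x j| <= `|x l|].
pose rk j := #|lev j|.
pose phi j : R := (rk j)%:R * (rk j).+1%:R.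
have levS j : lev j \subset S by apply/fintype.subsetP => l; rewrite inE => /andP[].
have rk_gt0 j : j \in S -> (0 < rk j)%N.
  by move=> jS; apply/card_gt0P; exists j; rewrite inE jS/=.
case: (@arg_maxP _ _ _ j0 (mem S) (fun j => `|x j| * phi j) j0S) => js jsS maxj0.
pose lam : R := `|x js|; set k := rk js.
have {maxj0} maxj j : j \in S -> `|x j| * phi j <= lam * phi js.
  exact: maxj0.
have k0 : (0 < k)%N by exact: rk_gt0.
suff lam_le : lam <= 2 * eps.
  have h1 := maxj _ j0S.
  have rkS j : (rk j <= #|S|)%N by exact: subset_leq_card.
  have h2 : phi js <= #|S|%:R * #|S|.+1%:R.
    by rewrite /phi -!natrM ler_nat leq_mul ?ltnS ?rkS.
  (* Rank at least 1 gives phi >= 2, which cancels the 2 of [lam <= 2 * eps]. *)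
  have h3 : 2 <= phi j0 by rewrite /phi -natrM ler_nat; have := rk_gt0 _ j0S; nia.
  have h4 : `|x j0| * 2 <= `|x j0| * phi j0 by rewrite ler_wpM2l.
  have h5 : lam * phi js <= 2 * eps * (#|S|%:R * #|S|.+1%:R).
    by apply: ler_pM => //; [exact: normr_ge0|rewrite /phi -natrM].
  by rewrite -mulrA; lra.
rewrite leNgt; apply/negP => lam_gt.
pose T := lev js; pose U := unique_nbhd A T :&: G.
pose r j : R := #|[set i in U | A i j]|%:R.
have UT : U \subset unique_nbhd A T by exact: finset.subsetIl.
have inT j : (j \in T) = (j \in S) && (lam <= `|x j|) by rewrite inE.
(* Among the coordinates outside [T] of rank at most l, let [j2] be the smallest in absolute value.
   Its level set contains [T] and all of these coordinates, yet has at most l elements, so its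
   excess bounds their edges into [U]. *)
have sumr l : \sum_(j in S :\: T | (rk j <= l)%N) r j <= dlt / 16 * l%:R.
  have [j1 j1P|none] := pickP [pred j | (j \in S :\: T) && (rk j <= l)%N];
    last by rewrite big_pred0// mulr_ge0//; lra.
  case: (arg_minP (fun j => `|x j| : R) j1P) => j2 /andP[j2D rkj2] min0.
  have {min0} minj j : (j \in S :\: T) && (rk j <= l)%N -> `|x j2| <= `|x j|.
    exact: min0.
  apply: (@le_trans _ _ (excess A (lev j2))%:R); last first.
    apply: le_trans (excS _ (levS _)) _.
    by rewrite ler_wpM2l ?ler_nat//; lra.
  have sub : T \subset lev j2.
    apply/fintype.subsetP => j; rewrite inT inE => /andP[jS lej]; rewrite jS/=.
    move: j2D; rewrite inE inT => /andP[+ j2S]; rewrite j2S/= -ltNge => /ltW.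
    by move/le_trans; exact.
  apply: le_trans (_ : (\sum_(j in lev j2 :\: T) #|[set i in U | A i j]|)%:R <= _);
    last by rewrite ler_nat excess_subset.
  rewrite natr_sum big_mkcond [leRHS]big_mkcond; apply: ler_sum => j _.
  case: ifPn => [jP|_]; last by case: ifP.
  move: (jP) => /andP[]; rewrite [j \in S :\: T]inE => /andP[jT jS] _.
  by rewrite inE jT inE jS minj.
(* Such a row sees exactly one coordinate [jj] of [T]; since the row sum is at most eps, the
   coordinates outside [T] must cancel the rest of [x jj]. *)
have rowU i : i \in U -> lam - eps <= \sum_(j in S :\: T | A i j) `|x j|.
  rewrite inE => /andP[iT /sumx le_eps].
  move: iT; rewrite inE => /cards1P[jj /setP jjP].
  have := jjP jj; rewrite !inE eqxx => /andP[/andP[jjS lejj] Aij].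
  have split : \sum_(j in S | A i j) x j =
      x jj + \sum_(j in S :\: T | A i j) x j.
    rewrite (bigD1 jj) ?jjS//=; congr (_ + _); apply: eq_bigl => j.
    have := jjP j; rewrite !inE -/lam.
    by case: (j \in S) => //=; case: (A i j); rewrite ?andbF ?andbT//= => <-.
  have : `|x jj| <= `|\sum_(j in S | A i j) x j| +
      `|\sum_(j in S :\: T | A i j) x j|.
    rewrite {1}(_ : x jj = \sum_(j in S | A i j) x j -
      \sum_(j in S :\: T | A i j) x j) ?ler_normB//.
    by rewrite split addrK.
  have : `|\sum_(j in S :\: T | A i j) x j| <=
      \sum_(j in S :\: T | A i j) `|x j| by exact: ler_norm_sum.
  by move: lejj; rewrite -/lam; lra.
have sumU : #|U|%:R * (lam - eps) <= \sum_(j in S :\: T) `|x j| * r j.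
  have -> : \sum_(j in S :\: T) `|x j| * r j =
      \sum_(i in U) \sum_(j in S :\: T | A i j) `|x j|.
    rewrite (exchange_big_dep (mem (S :\: T)))/=; last by move=> i j _ /andP[].
    apply: eq_bigr => j jD; rewrite /r mulr_natr -sumr_const.
    by apply: eq_bigl => i; rewrite [LHS]inE jD.
  by rewrite mulrC mulr_natr -sumr_const; exact: ler_sum.
have rkD j : j \in S :\: T -> (k < rk j)%N.
  rewrite inE inT => /andP[+ jS]; rewrite jS/= -ltNge => ltj.
  apply: proper_card; apply/properP; split.
    apply/fintype.subsetP => l; rewrite !inE => /andP[-> /=].
    by apply: le_trans; exact: ltW.
  by exists j; rewrite inE jS//= -ltNge.
have a0 : 0 <= dlt / 16 by lra.
have := weighted_rank_sum a0 k0 rkD sumr => wsum.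
have lam0 : 0 <= lam by exact: normr_ge0.
have : \sum_(j in S :\: T) `|x j| * r j <= lam * k%:R * (dlt / 8).
  apply: le_trans (_ : lam * phi js * \sum_(j in S :\: T)
      r j / ((rk j)%:R * (rk j).+1%:R) <= _).
    rewrite mulr_sumr; apply: ler_sum => j jD.
    have jS : j \in S by move: jD; rewrite inE => /andP[].
    have phi0 : 0 < phi j by rewrite /phi -natrM ltr0n muln_gt0 rk_gt0.
    rewrite mulrCA -/(phi j) mulrC; apply: ler_wpM2l; first exact: ler0n.
    by rewrite ler_pdivlMr// maxj.
  apply: le_trans (_ : lam * phi js * (2 * (dlt / 16) / k.+1%:R) <= _).
    by apply: ler_wpM2l => //; rewrite mulr_ge0// /phi -natrM.
  rewrite /phi -/k le_eqVlt; apply/orP; left; apply/eqP; field.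
  by rewrite nat1r pnatr_eq0.
have hU := uniqS _ (levS js); rewrite -/U -[#|lev js|]/k in hU.
have : #|U|%:R * (lam / 2) <= #|U|%:R * (lam - eps) by rewrite ler_wpM2l//; lra.
have : 7 / 16 * dlt * k%:R * (lam / 2) <= #|U|%:R * (lam / 2).
  by rewrite ler_wpM2r//; lra.
have : 0 < dlt * k%:R * lam by rewrite !mulr_gt0 ?ltr0n//; lra.
move: sumU; set sm := \sum_(j in _) _.
move: (#|U|%:R * (lam - eps)) => y.
move: (lam) (k%:R) (#|U|%:R) sm => lam' k' u sm.
lra.
Qed.

(** * From expansion to erasure robustness *)

Lemma ler_mx_norm_entry (K : realDomainType) (m n : nat) (M : 'M[K]_(m, n))
    (i : 'I_m) (j : 'I_n) : `|M i j| <= mx_norm M.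
Proof.
rewrite mx_normrE.
exact: (le_bigmax_cond 0 (fun ij : 'I_m * 'I_n => `|M ij.1 ij.2|) (j := (i, j))).
Qed.

Lemma l2norm_le_sup (R : realType) (n : nat) (x : 'cV[R]_n) (y : R) :
  0 <= y -> (forall i, `|x i 0| <= y) -> l2norm x <= n%:R * y.
Proof.
move=> y0 xy; rewrite /l2norm -[leRHS]ger0_norm ?mulr_ge0// -sqrtr_sqr.
apply: ler_wsqrtr; apply: (@le_trans _ _ (n%:R * y ^+ 2)).
  rewrite mulr_natl -[X in _ *+ X]card_ord -sumr_const; apply: ler_sum => i _.
  by rewrite -real_normK ?num_real// ler_sqr ?nnegrE.
rewrite exprMn ler_wpM2r ?sqr_ge0// -natrX ler_nat.
by case: n {x xy} => // n; rewrite leq_pmulr.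
Qed.

(** [absorbing_set] and [sup_bound] apply with dlt = d/4, for which d/64 is dlt/16; the second is
    used on the support of x outside [C]. *)
Lemma erasure_robust_of_expansion (R : realType) (m n b : nat)
    (A : 'I_m -> 'I_n -> bool) (p d : R) :
    d = p * m%:R -> 0 < p -> 40 <= d -> b%:R <= m%:R / d ^+ 4 ->
    (forall j, d / 4 <= (col_deg A j)%:R) ->
    (forall S : {set 'I_n}, #|S|%:R * p <= 1 / 512 ->
      (excess A S)%:R <= d / 64 * #|S|%:R) ->
  erasure_robust (\matrix_(i, j) (A i j)%:R) b (2 * b)
    (d ^+ 4 * n%:R ^+ 6) (m%:R / d ^+ 3).
Proof.
move=> dE p0 d40 bd degA excA B leB.
have d0 : 0 < d by lra.
have d44 : 4 <= d / 4 by lra.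
pose small (S : {set 'I_n}) := #|S|%:R * p <= 1 / 512 :> R.
have excA' S : small S -> (excess A S)%:R <= d / 4 / 16 * #|S|%:R.
  by move=> /excA; lra.
have sm0 : small finset.set0 by rewrite /small cards0 mul0r; lra.
have [C [smC leC expC]] := absorbing_set B d44 degA sm0 excA'.
have leCb : (#|C| <= b)%N by exact: leq_trans leC leB.
exists C; split; first by rewrite (leq_trans leCb)// leq_pmull.
move=> x; have [|lt_tau] := lerP (m%:R / d ^+ 3) (l0norm x)%:R; [by left|right].
pose supp := [set j : 'I_n | x j 0 != 0]; pose S := supp :\: C.
have mE : m%:R = d / p by rewrite dE mulrC mulKf// gt_eqF.
(* Here |S| p <= 1/d^2 and |C| p <= 1/d^3, and d >= 40 brings the sum below 1/512. Every set of
   columns met later is no larger than S and C together. *)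
have small_SC : (#|S| + #|C|)%:R * p <= 1 / 512.
  have h1 : #|S|%:R <= m%:R / d ^+ 3.
    apply: le_trans (ltW lt_tau).
    by rewrite ler_nat; apply/subset_leq_card/subsetDl.
  have h2 : #|C|%:R <= m%:R / d ^+ 4.
    by apply: le_trans bd; rewrite ler_nat.
  pose u := d^-1; have u0 : 0 < u by rewrite invr_gt0.
  have du : d * u = 1 by rewrite mulfV// gt_eqF.
  have u_le : u <= 1 / 40 by clear -du d40 u0; nra.
  have h3 : #|S|%:R * p <= u * u.
    have -> : u * u = m%:R / d ^+ 3 * p by rewrite mE /u; field; lra.
    by rewrite ler_pM2r.
  have h4 : #|C|%:R * p <= u * u * u.
    have -> : u * u * u = m%:R / d ^+ 4 * p by rewrite mE /u; field; lra.
    by rewrite ler_pM2r.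
  have h5 : u * u <= 1 / 40 * (1 / 40) by apply: ler_pM => //; exact: ltW.
  have h6 : u * u * u <= 1 / 40 * (1 / 40) * (1 / 40).
    by apply: ler_pM => //; rewrite ltW// mulr_gt0.
  rewrite natrD mulrDl; lra.
have le_small (D : {set 'I_n}) : (#|D| <= #|S| + #|C|)%N -> small D.
  move=> leD; apply: le_trans small_SC; apply: ler_wpM2r; first exact: ltW.
  by rewrite ler_nat.
set eps := mx_norm _.
have eps0 : 0 <= eps by rewrite /eps mx_normrE; exact: bigmax_ge_id.
(* Rows that are neither erased nor adjacent to [C]: there the entry of Mx involves only the
   coordinates in [S]. *)
pose G := ~: (B :|: nbhd A C).
have SC (D : {set _}) : D \subset S -> [disjoint C & D].
  move=> DS; rewrite fintype.disjoint_subset; apply/fintype.subsetP => j jC; rewrite !inE.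
  by apply/negP => /(fintype.subsetP DS); rewrite !inE jC.
have sumG i : i \in G -> `|\sum_(j in S | A i j) x j 0| <= eps.
  rewrite !inE negb_or -leqNgt leqn0 => /andP[iB iC].
  have iB' : i \in ~: B by rewrite inE.
  apply: le_trans (ler_mx_norm_entry _ (enum_rank_in iB' i) 0).
  rewrite le_eqVlt; apply/orP; left; apply/eqP; congr `|_|.
  rewrite !mxE big_mkcond/=; apply: eq_bigr => j _.
  rewrite !mxE enum_rankK_in// !inE.
  case: (boolP (A i j)) => Aij; rewrite ?mul0r ?andbF// mul1r andbT.
  have -> : j \notin C.
    apply/negP => jC; move: iC; rewrite cards_eq0 => /eqP/setP/(_ j).
    by rewrite !inE jC Aij.
  by rewrite /=; case: eqP.
have xS := @sup_bound R _ _ A G S (fun j => x j 0) (d / 4) eps.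
have {}xS j : j \in S -> `|x j 0| <= eps * #|S|%:R * #|S|.+1%:R.
  apply: xS => //; first lra.
  - move=> D DS; rewrite /G -finset.setDE; apply: expC; first exact: SC.
      by apply: le_small; rewrite (leq_trans (subset_leq_card DS))// leq_addr.
    apply: le_small; apply: leq_trans (leq_card_setU C D) _.
    by rewrite addnC leq_add2r subset_leq_card.
  - move=> D DS; apply: excA'; apply: le_small.
    by rewrite (leq_trans (subset_leq_card DS))// leq_addr.
have Sn : (#|S| <= n)%N by rewrite -[leqRHS]card_ord max_card.
pose y := eps * #|S|%:R * #|S|.+1%:R.
have y0 : 0 <= y by rewrite !mulr_ge0.
apply: le_trans (l2norm_le_sup (y := y) y0 _) _.
  move=> i; rewrite mxE.
  have := enum_valP i; rewrite inE => iC.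
  have [x0|x0] := eqVneq (x (enum_val i) 0) 0; first by rewrite x0 normr0.
  by apply: xS; rewrite !inE iC.
have Cn : (#|~: C| <= n)%N by rewrite -[leqRHS]card_ord max_card.
rewrite /y -[eps * _ * _]mulrA mulrCA mulrC; apply: ler_wpM2r => //.
(* The factor n from [l2norm_le_sup] times |S|(|S|+1) is at most n^2 (n+1) <= 2 n^6, and 2 <=
   d^4. *)
rewrite -!natrM; apply: (@le_trans _ _ (2 * n ^ 6)%:R).
  rewrite ler_nat; apply: (@leq_trans (n * (n * n.+1))).
    by rewrite !leq_mul.
  case: (n) => // k; rewrite !expnS 2!(mulnCA 2) !leq_pmul2l//.
  by rewrite (@leq_trans (2 * k.+1))//; [by rewrite mulSn mul1n addSn ltnS leq_addl|rewrite leq_pmul2l// leq_pmulr].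
rewrite natrM natrX ler_wpM2r ?exprn_ge0//.
have d1 : 1 <= d ^+ 3 by rewrite exprn_ege1//; lra.
rewrite -[2%:R]mul1r exprSr ler_pM//; lra.
Qed.

(** * Bernoulli product weights on 0/1 matrices and their generating functions *)

(** Nested finite functions make the 0/1 matrices a finite type grouped by rows, so that
    expectations become finite sums factoring over rows. *)
Definition ffun2 (I J : finType) (M : {ffun I -> {ffun J -> bool}}) :
  I -> J -> bool := fun i j => M i j.

Definition row_weight (R : pzRingType) (J : finType) (p : R)
    (r : {ffun J -> bool}) : R := \prod_j (if r j then p else 1 - p).

Definition mx_weight (R : pzRingType) (I J : finType) (p : R)
    (M : {ffun I -> {ffun J -> bool}}) : R := \prod_i row_weight p (M i).

Lemma mx_weight_ge0 (R : numDomainType) (I J : finType) (p : R)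
    (M : {ffun I -> {ffun J -> bool}}) : 0 <= p <= 1 -> 0 <= mx_weight p M.
Proof.
move=> /andP[p0 p1]; apply: prodr_ge0 => i _; apply: prodr_ge0 => j _.
by case: ifP; rewrite ?subr_ge0.
Qed.

(** The binomial generating function: by distributivity each column of [S] contributes 1 - p + pz
    and every other column contributes 1. *)
Lemma sum_row_weight (R : comPzRingType) (J : finType) (p z : R) (S : {set J}) :
  \sum_r row_weight p r * z ^+ #|[set j in S | r j]%SET| =
    (1 - p + p * z) ^+ #|S|.
Proof.
pose F j (b : bool) := (if b then p else 1 - p) * z ^+ ((j \in S) && b).
transitivity (\sum_(r : {ffun J -> bool}) \prod_j F j (r j)).
  apply: eq_bigr => r _; rewrite big_split/=; congr (_ * _).
  rewrite prodrXr -sum1_card big_mkcond/=; congr (z ^+ _).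
  by apply: eq_bigr => j _; rewrite inE; case: (_ && _).
rewrite -bigA_distr_bigA -prodr_const [RHS]big_mkcond/=.
apply: eq_bigr => j _; rewrite big_bool /F andbT andbF.
by case: (j \in S); rewrite /= ?expr1 ?expr0 !mulr1 addrC ?subrK.
Qed.

Lemma sum_mx_weight (R : comPzRingType) (I J : finType) (p : R)
    (F : {ffun J -> bool} -> R) :
  \sum_(M : {ffun I -> {ffun J -> bool}}) mx_weight p M * \prod_i F (M i) =
    (\sum_r row_weight p r * F r) ^+ #|I|.
Proof.
under eq_bigr do rewrite -big_split/=.
by rewrite -(bigA_distr_bigA (fun _ r => row_weight p r * F r)) prodr_const.
Qed.

Lemma sum_mx_weight1 (R : comPzRingType) (I J : finType) (p : R) :
  \sum_(M : {ffun I -> {ffun J -> bool}}) mx_weight p M = 1.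
Proof.
have sum1 : \sum_(r : {ffun J -> bool}) row_weight p r * 1 = 1.
  have := sum_row_weight p 1 (@finset.set0 J).
  by rewrite cards0 expr0; under eq_bigr do rewrite expr1n.
rewrite -[RHS](expr1n _ #|I|) -[X in X ^+ _]sum1 -sum_mx_weight.
by apply: eq_bigr => M _; rewrite big1 ?mulr1.
Qed.

Lemma sum_mx_weight_col_deg (R : comPzRingType) (I J : finType) (p z : R)
    (j : J) :
  \sum_(M : {ffun I -> {ffun J -> bool}}) mx_weight p M * z ^+ col_deg (ffun2 M) j =
    (1 - p + p * z) ^+ #|I|.
Proof.
rewrite -[X in X ^+ #|I|]expr1 -(cards1 j) -sum_row_weight -sum_mx_weight.
apply: eq_bigr => M _; rewrite prodrXr; congr (_ * z ^+ _).
rewrite /col_deg -sum1_card big_mkcond/=; apply: eq_bigr => i _.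
rewrite inE -sum1_card; case: ifP => Mij.
  by rewrite (big_pred1 j)// => l; rewrite !inE andbC; case: eqP => [->|]; rewrite ?andbF ?andbT.
by rewrite big_pred0// => l; rewrite !inE andbC; case: eqP => [->|]; rewrite ?andbF ?andbT.
Qed.

Lemma sum_mx_weight_excess (R : fieldType) (I J : finType) (p : R)
    (S : {set J}) : 2 != 0 :> R ->
  \sum_(M : {ffun I -> {ffun J -> bool}}) mx_weight p M * 2 ^+ excess (ffun2 M) S =
    (((1 + p) ^+ #|S| + (1 - p) ^+ #|S|) / 2) ^+ #|I|.
Proof.
move=> two.
pose F (r : {ffun J -> bool}) : R := 2 ^+ #|[set j in S | r j]%SET|.-1.
transitivity (\sum_(M : {ffun I -> {ffun J -> bool}})
    mx_weight p M * \prod_i F (M i)).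
  by apply: eq_bigr => M _; rewrite /excess prodrXr.
rewrite sum_mx_weight; congr (_ ^+ _).
(* [2 ^ k.-1 = (2 ^ k + 0 ^ k) / 2], and both terms factor over the columns. *)
have -> : (1 + p) ^+ #|S| =
    \sum_r row_weight p r * 2 ^+ #|[set j in S | r j]%SET|.
  by rewrite sum_row_weight; congr (_ ^+ _); ring.
have -> : (1 - p) ^+ #|S| =
    \sum_r row_weight p r * 0 ^+ #|[set j in S | r j]%SET|.
  by rewrite sum_row_weight mulr0 addr0.
rewrite -big_split/= mulr_suml; apply: eq_bigr => r _; rewrite /F -mulrDr -mulrA.
congr (_ * _); case: #|_| => [|k] /=; first by rewrite !expr0 divff.
by rewrite exprS expr0n/= addr0 mulrC mulKf.
Qed.

(** * Union bound, Markov inequality and tail estimates *)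

Lemma sum_exists_le (R : numDomainType) (T K : finType) (W : T -> R)
    (Q : K -> pred T) : (forall t, 0 <= W t) ->
  \sum_(t | [exists k, Q k t]) W t <= \sum_k \sum_(t | Q k t) W t.
Proof.
move=> W0; under [leRHS]eq_bigr do rewrite big_mkcond.
rewrite exchange_big big_mkcond/=; apply: ler_sum => t _; case: ifP.
  move=> /existsP[k Qk]; rewrite (bigD1 k)//= Qk lerDl.
  by apply: sumr_ge0 => l _; case: ifP.
by move=> _; apply: sumr_ge0 => l _; case: ifP.
Qed.

Lemma markov_sum (R : numFieldType) (T : finType) (W g : T -> R) (Q : pred T)
    (c : R) : (forall t, 0 <= W t) -> (forall t, 0 <= g t) -> 0 < c ->
    (forall t, Q t -> c <= g t) ->
  \sum_(t | Q t) W t <= (\sum_t W t * g t) / c.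
Proof.
move=> W0 g0 c0 cg; rewrite mulr_suml big_mkcond; apply: ler_sum => t _.
case: ifPn => [Qt|_]; first by rewrite ler_pdivlMr// ler_wpM2l// cg.
by rewrite divr_ge0 ?mulr_ge0// ltW.
Qed.

Lemma expR_le_inv (R : realType) (x : R) : x < 1 -> expR x <= (1 - x)^-1.
Proof.
move=> x1; rewrite -[x in expR x]opprK expRN lef_pV2 ?posrE ?expR_gt0 ?subr_gt0//.
exact: expR_ge1Dx.
Qed.

Lemma expR_half_le2 (R : realType) : expR (1 / 2) <= 2 :> R.
Proof.
rewrite [leRHS](_ : 2 = (1 - 1 / 2)^-1); last by field.
by apply: expR_le_inv; lra.
Qed.

Lemma expR1_le4 (R : realType) : expR 1 <= 4 :> R.
Proof.
have -> : expR 1 = expR (1 / 2) * expR (1 / 2) :> R.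
  by rewrite -expRD; congr expR; field.
rewrite [leRHS](_ : 4 = 2 * 2); last by rewrite -natrM.
by apply: ler_pM; rewrite ?expR_ge0 ?expR_half_le2.
Qed.

(** Chernoff bound with z = 1/2: the moment is (1 - p/2)^m <= e^(-d/2), and the threshold e^(-d/4)
    is valid because 1/e <= 1/2. *)
Lemma sum_col_deg_lt (R : realType) (m n : nat) (p d : R) (j : 'I_n) :
    d = p * m%:R -> 0 <= p <= 1 ->
  \sum_(M : {ffun 'I_m -> {ffun 'I_n -> bool}} | (col_deg (ffun2 M) j)%:R < d / 4)
    mx_weight p M <= expR (- (d / 4)).
Proof.
move=> dE p01; apply: le_trans (markov_sum (g := fun M => 2^-1 ^+ col_deg (ffun2 M) j)
  (c := expR (- (d / 4))) _ _ _ _) _.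
- by move=> M; exact: mx_weight_ge0.
- by move=> M; rewrite exprn_ge0// invr_ge0.
- exact: expR_gt0.
- move=> M /ltW le_d; apply: (@le_trans _ _ (expR (- 1) ^+ col_deg (ffun2 M) j)).
    by rewrite -expRM_natr ler_expR; lra.
  apply: lerXn2r; rewrite ?nnegrE ?expR_ge0 ?invr_ge0//.
  by apply: le_trans (expR_le_inv _) _; rewrite ?opprK//; lra.
rewrite sum_mx_weight_col_deg card_ord -expRN opprK.
apply: (@le_trans _ _ (expR (- (p / 2)) ^+ m * expR (d / 4))).
  rewrite ler_wpM2r ?expR_ge0//; case/andP: p01 => p0 p1.
  apply: lerXn2r; rewrite ?nnegrE ?expR_ge0//; first lra.
  by apply: le_trans (expR_ge1Dx _); lra.
by rewrite -expRM_natr -expRD ler_expR dE; lra.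
Qed.

(** Markov for 2^excess, with threshold e^(d|S|/128) because e^(1/2) <= 2. With u = |S| p, averaging
    (1+p)^|S| and (1-p)^|S| cancels the first order in u, so a row has moment at most e^(2u^2). Over
    m rows the exponent is 2 d |S| u <= d|S|/256 by u <= 1/512, half of what the threshold takes
    away. *)
Lemma sum_excess_gt (R : realType) (m n : nat) (p d : R) (S : {set 'I_n}) :
    d = p * m%:R -> 0 <= p <= 1 -> #|S|%:R * p <= 1 / 512 ->
  \sum_(M : {ffun 'I_m -> {ffun 'I_n -> bool}} |
      d / 64 * #|S|%:R < (excess (ffun2 M) S)%:R) mx_weight p M
    <= expR (- (d / 256)) ^+ #|S|.
Proof.
move=> dE p01 small; have /andP[p0 p1] := p01.
apply: le_trans (markov_sum (g := fun M => 2 ^+ excess (ffun2 M) S)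
  (c := expR (d / 128 * #|S|%:R)) _ _ _ _) _.
- by move=> M; exact: mx_weight_ge0.
- by move=> M; rewrite exprn_ge0.
- exact: expR_gt0.
- move=> M /ltW le_d; apply: (@le_trans _ _ (expR (1 / 2) ^+ excess (ffun2 M) S)).
    by rewrite -expRM_natr ler_expR; lra.
  by apply: lerXn2r; rewrite ?nnegrE ?expR_ge0// expR_half_le2.
rewrite sum_mx_weight_excess ?pnatr_eq0// card_ord -expRN.
set s : R := #|S|%:R; pose u := s * p.
have u0 : 0 <= u by rewrite mulr_ge0.
have u1 : u <= 1 / 512 by [].
have le1 : (1 + p) ^+ #|S| <= (1 - u)^-1.
  apply: le_trans (expR_le_inv (x := u) _); last lra.
  rewrite /u expRM_natl; apply: lerXn2r; rewrite ?nnegrE ?expR_ge0//; first lra.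
  exact: expR_ge1Dx.
have le2 : (1 - p) ^+ #|S| <= (1 + u)^-1.
  rewrite -[u]opprK; apply: le_trans (expR_le_inv (x := - u) _); last lra.
  rewrite /u -mulrN expRM_natl; apply: lerXn2r; rewrite ?nnegrE ?expR_ge0//; first lra.
  exact: expR_ge1Dx.
(* The chain is 1/2 (1/(1-u) + 1/(1+u)) = 1/(1-u^2) <= 1 + 2u^2 <= e^(2u^2). *)
have le3 : ((1 + p) ^+ #|S| + (1 - p) ^+ #|S|) / 2 <= expR (2 * u * u).
  apply: le_trans (expR_ge1Dx _).
  have -> : 1 + 2 * u * u = (1 - u * u)^-1 + (1 - 2 * (u * u)) * (u * u) / (1 - u * u).
    by field; nra.
  have uu : u * u <= 1 / 512 * (1 / 512) by exact: ler_pM.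
  have : 0 <= (1 - 2 * (u * u)) * (u * u) / (1 - u * u).
    by rewrite divr_ge0 ?mulr_ge0//; lra.
  have : (1 - u * u)^-1 = ((1 - u)^-1 + (1 + u)^-1) / 2.
    by field; apply/and3P; split; nra.
  lra.
apply: (@le_trans _ _ (expR (2 * u * u) ^+ m * expR (- (d / 128 * s)))).
  rewrite ler_wpM2r ?expR_ge0//; apply: lerXn2r; rewrite ?nnegrE ?expR_ge0//.
  by rewrite divr_ge0// addr_ge0// exprn_ge0//; lra.
rewrite -!expRM_natr -expRD ler_expR -/s.
have -> : 2 * u * u * m%:R = 2 * (d * s) * u by rewrite /u dE; ring.
have : d * s * u <= d * s * (1 / 512).
  by rewrite ler_wpM2l// dE !mulr_ge0.
lra.
Qed.

(** With q = e^(-d/256), the columns cost at most nq and the nonempty sets at most (1+q)^n - 1 <=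
    1/(1-nq) - 1 <= 2nq, the last step by nq <= 1/2. *)
Lemma sum_bad_weight (R : realType) (m n : nat) (p d : R) :
    d = p * m%:R -> 0 <= p <= 1 -> n%:R * expR (- (d / 256)) <= 1 / 2 ->
  \sum_(M : {ffun 'I_m -> {ffun 'I_n -> bool}} |
      [exists j, (col_deg (ffun2 M) j)%:R < d / 4] ||
      [exists S : {set 'I_n}, (#|S|%:R * p <= 1 / 512) &&
        (d / 64 * #|S|%:R < (excess (ffun2 M) S)%:R)])
    mx_weight p M <= 3 * n%:R * expR (- (d / 256)).
Proof.
move=> dE p01 nq; set q := expR _ in nq *.
have W0 (M : {ffun 'I_m -> {ffun 'I_n -> bool}}) : 0 <= mx_weight p M.
  exact: mx_weight_ge0.
have q0 : 0 <= q by exact: expR_ge0.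
have d0 : 0 <= d by case/andP: p01 => p0 _; rewrite dE mulr_ge0.
rewrite (bigID (fun M => [exists j, (col_deg (ffun2 M) j)%:R < d / 4]))/=.
apply: (@le_trans _ _ (n%:R * q + ((1 + q) ^+ n - 1))).
  apply: lerD.
    under eq_bigl do rewrite orbK.
    apply: le_trans (sum_exists_le _ W0) _.
    have -> : n%:R * q = \sum_(j < n) q by rewrite sumr_const card_ord mulr_natl.
    apply: ler_sum => j _.
    by apply: le_trans (sum_col_deg_lt j dE p01) _; rewrite ler_expR; lra.
  apply: (@le_trans _ _ (\sum_(M : {ffun 'I_m -> {ffun 'I_n -> bool}} |
      [exists S : {set 'I_n}, (#|S|%:R * p <= 1 / 512) &&
        (d / 64 * #|S|%:R < (excess (ffun2 M) S)%:R)]) mx_weight p M)).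
    rewrite big_mkcond [leRHS]big_mkcond; apply: ler_sum => M _.
    by case: [exists j, _] => /=; rewrite ?andbT ?andbF//; case: ifP.
  apply: le_trans (sum_exists_le _ W0) _.
  have -> : (1 + q) ^+ n = \sum_(S : {set 'I_n}) q ^+ #|S|.
    rewrite -[n in LHS]card_ord -prodr_const addrC bigA_distr.
    by apply: eq_bigr => S _; rewrite -big_mkcond/= prodr_const.
  (* The empty set has excess 0 and is never bad; dropping its term accounts for the -1. *)
  rewrite (bigD1 finset.set0)//= [in leRHS](bigD1 finset.set0)//=.
  rewrite cards0 expr0 [leRHS]addrC addKr big_pred0 ?add0r; last first.
    move=> M; rewrite mulr0 (_ : excess _ _ = 0%N) ?ltxx ?andbF//.
    rewrite /excess big1// => i _; rewrite /row_deg.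
    by apply/eqP; rewrite -leqn0 (leq_trans (leq_pred _))// leqn0 cards_eq0;
      apply/eqP/setP => l; rewrite !inE.
  apply: ler_sum => S _.
  case: (boolP (#|S|%:R * p <= 1 / 512)) => sS /=.
    exact: sum_excess_gt.
  by rewrite big_pred0// exprn_ge0.
have : (1 + q) ^+ n <= (1 - n%:R * q)^-1.
  apply: le_trans (expR_le_inv (x := n%:R * q) _); last lra.
  rewrite expRM_natl; apply: lerXn2r; rewrite ?nnegrE ?expR_ge0//; first lra.
  exact: expR_ge1Dx.
have nq0 : 0 <= n%:R * q by rewrite mulr_ge0.
have : (1 - n%:R * q)^-1 <= 1 + 2 * (n%:R * q).
  rewrite -[leLHS]mul1r ler_pdivrMr; last lra.
  by clear -nq nq0; move: (n%:R * q) nq nq0 => y; nra.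
lra.
Qed.

(** * Transfer from the probability space to finite sums *)

Local Open Scope classical_set_scope.

Lemma iid_bernoulli_prob_eq (m n : nat) (disp : measure_display)
    (T : measurableType disp) (R : realType) (P : probability T R) (p : R)
    (X : 'I_m * 'I_n -> {RV P >-> bool})
    (M : {ffun 'I_m -> {ffun 'I_n -> bool}}) :
    0 <= p <= 1 -> iid_bernoulli p X ->
  measurable [set w | forall i j, X (i, j) w = M i j] /\
  P [set w | forall i j, X (i, j) w = M i j] = (mx_weight p M)%:E.
Proof.
move=> p01 [distX indX]; pose A ij := [set M (ij.1 : 'I_m) (ij.2 : 'I_n)].
have -> : [set w | forall i j, X (i, j) w = M i j] =
    \bigcap_(ij in [set` [set: 'I_m * 'I_n]%SET]) (X ij @^-1` A ij).
  apply/seteqP; split=> w /=; first by move=> XM [i j] _; exact: XM.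
  by move=> XM i j; apply: (XM (i, j)); rewrite /= inE.
split.
  apply: fin_bigcap_measurable; first exact: finite_finpred.
  by move=> ij _; exact: measurable_funPTI.
rewrite (indX _ A) => [|ij _//]; under eq_bigl do rewrite inE.
rewrite /mx_weight /row_weight pair_big -prodEFin/=; apply: eq_bigr => -[i j] _.
have -> : P (X (i, j) @^-1` A (i, j)) = distribution P (X (i, j)) (A (i, j)) by [].
rewrite distX bernoulli_probE// /A !diracE/=.
case: (M i j).
  by rewrite mem_set// memNset//= mule1 mule0 adde0.
by rewrite memNset// mem_set//= mule1 mule0 add0e.
Qed.

(** The event is a finite disjoint union of the measurable events that fix every entry, so [Q] may
    be an arbitrary predicate. *)
Lemma iid_bernoulli_prob_sum (m n : nat) (disp : measure_display)
    (T : measurableType disp) (R : realType) (P : probability T R) (p : R)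
    (X : 'I_m * 'I_n -> {RV P >-> bool})
    (Q : ('I_m -> 'I_n -> bool) -> Prop) : 0 <= p <= 1 -> iid_bernoulli p X ->
  P [set w | Q (fun i j => X (i, j) w)] =
    (\sum_(M : {ffun 'I_m -> {ffun 'I_n -> bool}} | `[< Q (ffun2 M) >])
      mx_weight p M)%:E.
Proof.
move=> p01 iidX.
pose E M := [set w | forall i j, X (i, j) w = M i j] : set T.
pose D := [set` [pred M : {ffun 'I_m -> {ffun 'I_n -> bool}} | `[< Q (ffun2 M) >]]].
have -> : [set w | Q (fun i j => X (i, j) w)] = \bigcup_(M in D) E (ffun2 M).
  apply/seteqP; split=> w /=.
    move=> Qw; pose M := [ffun i => [ffun j => X (i, j) w]].
    have EM : ffun2 M = (fun i j => X (i, j) w).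
      by apply/funext => i; apply/funext => j; rewrite /ffun2 !ffunE.
    exists M; last by move=> i j; rewrite EM.
    by rewrite /D/= inE EM.
  move=> [M]; rewrite /D/= inE => QM EM.
  rewrite (_ : (fun i j => _) = ffun2 M)//.
  by apply/funext => i; apply/funext => j; rewrite EM.
rewrite measure_fin_bigcup; first last.
- by move=> M _; have [] := iid_bernoulli_prob_eq M p01 iidX.
- move=> M M' _ _ [w [EM EM']]; apply/ffunP => i; apply/ffunP => j.
  by rewrite -[LHS]EM -[RHS]EM'.
- exact: finite_finpred.
rewrite /D -(bigfs (r := index_enum _) _ (index_enum_uniq _)); last first.
  by move=> M _; rewrite mem_index_enum.
rewrite -sumEFin; apply: eq_bigr => M _.
by have [] := iid_bernoulli_prob_eq M p01 iidX.
Qed.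

(** * Choice of constants and conclusion *)

Theorem theorem4p15 (R : realType) :
  exists (N : nat) (C K : R), [/\ 0 < C, 0 < K &
    forall (n m : nat) (p : R),
      (N <= n)%N -> (0 < m)%N -> (m <= n)%N ->
      0 < p -> p < 1 ->
      C * (ln n%:R ^+ 2) / m%:R <= p ->
    forall (disp : measure_display) (T : measurableType disp)
      (P : probability T R) (X : 'I_m * 'I_n -> {RV P >-> bool}),
      iid_bernoulli p X ->
      let d := p * m%:R in
      ((1 - K / m%:R ^+ 2)%:E <=
       P [set w | (forall b : nat, b%:R <= m%:R / d ^+ 4 ->
            erasure_robust (random_mx X w) b (2 * b)
              (d ^+ 4 * n%:R ^+ 6) (m%:R / d ^+ 3))%R])%E].
Proof.
(* N = 4 gives ln n >= 1 through e <= 4, so that d >= 768 ln n. As 768 = 3 * 256, this makes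
   e^(-d/256) at most n^(-3), and the bad weight 3nq is at most 3/n^2; hence K = 3. *)
exists 4, 768, 3; split; rewrite ?ltr0n// => n m p n4 m0 mn p0 p1 dp disp T P X iidX.
move dE : (p * m%:R) => d; cbv zeta.
have p01 : 0 <= p <= 1 by rewrite !ltW.
have nR0 : 0 < n%:R :> R by rewrite ltr0n; exact: leq_trans n4.
have mR0 : 0 < m%:R :> R by rewrite ltr0n.
have ln1 : 1 <= ln n%:R :> R.
  rewrite -[leLHS]expRK ler_ln ?posrE ?expR_gt0//.
  by apply: le_trans (expR1_le4 R) _; rewrite ler_nat.
have d_ge : 768 * ln n%:R <= d.
  rewrite -dE; apply: (@le_trans _ _ (768 * ln n%:R ^+ 2)); last first.
    by rewrite -ler_pdivrMr.
  apply: ler_wpM2l; first by rewrite ler0n.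
  by rewrite expr2 ler_peMl ?(le_trans ler01 ln1).
have d40 : 40 <= d by lra.
pose q := expR (- (d / 256)).
have q_le : q <= (n%:R ^+ 3)^-1.
  rewrite -[X in X ^+ 3](lnK nR0) -expRM_natl -expRN ler_expR; lra.
have nq_le : n%:R * q <= (n%:R ^+ 2)^-1.
  apply: (@le_trans _ _ (n%:R * (n%:R ^+ 3)^-1)); first by rewrite ler_pM2l.
  by rewrite le_eqVlt; apply/orP; left; apply/eqP; field; rewrite gt_eqF.
pose Q (A : 'I_m -> 'I_n -> bool) := forall b : nat, b%:R <= m%:R / d ^+ 4 ->
  erasure_robust (\matrix_(i, j) (A i j)%:R) b (2 * b)
    (d ^+ 4 * n%:R ^+ 6) (m%:R / d ^+ 3).
rewrite (iid_bernoulli_prob_sum Q p01 iidX) lee_fin.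
pose bad (M : {ffun 'I_m -> {ffun 'I_n -> bool}}) :=
  [exists j, (col_deg (ffun2 M) j)%:R < d / 4] ||
  [exists S : {set 'I_n}, (#|S|%:R * p <= 1 / 512) &&
    (d / 64 * #|S|%:R < (excess (ffun2 M) S)%:R)].
(* [bad] does not involve b, so one good matrix serves all b at once. *)
have goodQ M : ~~ bad M -> Q (ffun2 M).
  rewrite negb_or !negb_exists => /andP[/forallP degM /forallP excM] b bd.
  apply: (erasure_robust_of_expansion (p := p)) => //.
  - by move=> j; rewrite leNgt degM.
  - move=> S smS; have := excM S; rewrite smS/= -leNgt; exact.
have badW : \sum_(M | bad M) mx_weight p M <= 3 * n%:R * q.
  apply: sum_bad_weight => //; apply: le_trans nq_le _.
  rewrite [leRHS]mul1r lef_pV2 ?posrE ?exprn_gt0// -natrX ler_nat.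
  by rewrite (leq_trans _ (leq_pexp2l _ (ltn0Sn 1)))// (leq_trans _ n4).
apply: (@le_trans _ _ (\sum_(M | ~~ bad M) mx_weight p M)); last first.
  rewrite big_mkcond [leRHS]big_mkcond; apply: ler_sum => M _.
  case: ifPn => [gM|_]; first by rewrite (asboolT (goodQ _ gM)).
  by case: ifP => // _; exact: mx_weight_ge0.
have := sum_mx_weight1 'I_m 'I_n p; rewrite (bigID bad)/= => tot.
(* Here m <= n turns 1/n^2 into 1/m^2. *)
have : 3 * (n%:R * q) <= 3 / m%:R ^+ 2.
  rewrite ler_pM2l// (le_trans nq_le)// lef_pV2 ?posrE ?exprn_gt0//.
  by rewrite lerXn2r ?nnegrE ?ler_nat// ltW.
lra.
Qed.
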